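(* Let $\xi=(\xi_k)_{k\in\mathbf{N}_0}$ be a sequence of independent and identically distributed $\mathbf{R}^Z$-valued random vectors with (common) support $\mathbf{\Xi}\subset\mathbf{R}^Z$, and let $A:\mathbf{\Xi}\to\mathbf{R}^{n\times n}$, $B:\mathbf{\Xi}\to\mathbf{R}^{n\times p_w}$, $C:\mathbf{\Xi}\to\mathbf{R}^{q_z\times n}$, $D:\mathbf{\Xi}\to\mathbf{R}^{q_z\times p_w}$ be Borel functions such that the squares of all entries of $A(\xi_0),B(\xi_0),C(\xi_0),D(\xi_0)$ are Lebesgue integrable (have finite expectation). Let $G$ be the system $x_{k+1}=A(\xi_k)x_k+B(\xi_k)w_k$, $z_k=C(\xi_k)x_k+D(\xi_k)w_k$. For given $\gamma>0$, the following two conditions are equivalent. 1. The system $G$ is exponentially stable in the second moment and satisfies $\|G\|_2<\gamma$. 2. There exists a (symmetric) positive definite matrix $P\in\mathbf{R}^{n\times n}$ such that $$E[P-A(\xi_0)^TPA(\xi_0)-C(\xi_0)^TC(\xi_0)]>0,$$ $$E[\mathrm{tr}(D(\xi_0)^TD(\xi_0)+B(\xi_0)^TPB(\xi_0))]<\gamma^2.$$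
   Context: $\mathbf{N}_0$ denotes the non-negative integers. For symmetric matrices, $>0$ means positive definite. In the system $G$, $x_k\in\mathbf{R}^n$ is the state, $w_k\in\mathbf{R}^{p_w}$ the input, $z_k\in\mathbf{R}^{q_z}$ the output, and the initial state $x_0$ is deterministic. Exponential stability in the second moment: $G$ is exponentially stable in the second moment if, for $w\equiv0$, there exist $a>0$ and $\lambda\in(0,1)$ such that $\sqrt{E[\|x_k\|^2]}\le a\|x_0\|\lambda^k$ for all $k\in\mathbf{N}_0$ and all $x_0\in\mathbf{R}^n$, where $\|\cdot\|$ is the Euclidean norm. State transition matrix: for $k_1,k_2\in\mathbf{N}_0$ with $k_2\ge k_1$, $\Phi_{k_1}^{k_2}:=I$ if $k_2=k_1$, and $\Phi_{k_1}^{k_2}:=A(\xi_{k_2-1})A(\xi_{k_2-2})\cdots A(\xi_{k_1})$ if $k_2\ge k_1+1$. $H_2$ norm: for $G$ exponentially stable in the second moment, $\|G\|_2:=\sqrt{s_\infty}$, where $s_\infty=\lim_{K\to\infty}s_K$ (this limit exists and is finite for such $G$) and $$s_K:=E\left[\mathrm{tr}\left(D(\xi_0)^TD(\xi_0)\right)\right]+\sum_{k=1}^K E\left[\mathrm{tr}\left(B(\xi_0)^T(\Phi_1^k)^TC(\xi_k)^TC(\xi_k)\Phi_1^kB(\xi_0)\right)\right].$$ *)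

(* Defs.v *)
From HB Require Import structures.
From mathcomp Require Import all_boot all_order all_algebra.
From mathcomp Require Import all_classical all_reals all_analysis.
Set Implicit Arguments.
Unset Strict Implicit.
Unset Printing Implicit Defensive.
Import Order.TTheory GRing.Theory Num.Theory.
Import numFieldNormedType.Exports.
Local Open Scope classical_set_scope.
Local Open Scope ring_scope.

(* Real matrices with their Borel sigma-algebra; R^Z is [borel_mx R Z 1]. *)
Definition borel_mx (R : realType) (m n : nat) :=
  g_sigma_algebraType (@open 'M[R]_(m, n)).

Section matrices.
Context (R : realType).

Definition eucl_norm (n : nat) (x : 'cV[R]_n) : R :=
  Num.sqrt (\sum_(i < n) x i 0 ^+ 2).

Definition posdefmx (n : nat) (M : 'M[R]_n) : Prop :=
  M^T = M /\ forall x : 'cV[R]_n, x != 0 -> 0 < (x^T *m M *m x) 0 0.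

End matrices.

Section random_vectors.
Context d (T : measurableType d) (R : realType) (P : probability T R).

Definition mx_expectation (m n : nat) (X : T -> 'M[R]_(m, n)) : 'M[R]_(m, n) :=
  \matrix_(i, j) fine ('E_P[(fun t => X t i j)%R]).

Context (Z : nat).
Implicit Types xi : nat -> {RV P >-> borel_mx R Z 1}.

(* The laws are compared on Borel sets only: [distribution] has unspecified
   values on the other sets. *)
Definition identically_distributed xi : Prop :=
  forall k (U : set (borel_mx R Z 1)), measurable U ->
    distribution P (xi k) U = distribution P (xi 0%N) U.

Definition mutually_independent xi : Prop :=
  forall (J : seq nat) (U : nat -> set (borel_mx R Z 1)),
    uniq J -> (forall k, measurable (U k)) ->
    P (\bigcap_(k in [set` J]) (xi k @^-1` U k)) =
    (\prod_(k <- J) P (xi k @^-1` U k))%E.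

(* The support of a random vector is the smallest closed set that contains it
   with probability one. *)
Definition is_support (X : {RV P >-> borel_mx R Z 1}) (S : set 'cV[R]_Z) : Prop :=
  [/\ closed S, P (X @^-1` S) = 1%E &
      forall F : set 'cV[R]_Z, closed F -> P (X @^-1` F) = 1%E -> S `<=` F].

End random_vectors.

(* The coefficients are total functions on R^Z. They are meant to be specified
   on the support of [xi k] only; their values elsewhere affect only a null
   event. *)
Record system (R : realType) (Z n pw qz : nat) := System {
  sysA : 'cV[R]_Z -> 'M[R]_(n, n) ;
  sysB : 'cV[R]_Z -> 'M[R]_(n, pw) ;
  sysC : 'cV[R]_Z -> 'M[R]_(qz, n) ;
  sysD : 'cV[R]_Z -> 'M[R]_(qz, pw) }.

Section systems.
Context d (T : measurableType d) (R : realType) (P : probability T R).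
Context (Z n pw qz : nat).
Variables (xi : nat -> T -> 'cV[R]_Z) (G : system R Z n pw qz).

Fixpoint state (x0 : 'cV[R]_n) (w : nat -> T -> 'cV[R]_pw) (k : nat) (t : T) :
    'cV[R]_n :=
  if k is k'.+1 then
    sysA G (xi k' t) *m state x0 w k' t + sysB G (xi k' t) *m w k' t
  else x0.

Definition output (x0 : 'cV[R]_n) (w : nat -> T -> 'cV[R]_pw) (k : nat) (t : T) :
    'cV[R]_qz :=
  sysC G (xi k t) *m state x0 w k t + sysD G (xi k t) *m w k t.

Definition exp_stable2 : Prop :=
  exists a lambda : R, [/\ 0 < a, 0 < lambda, lambda < 1 &
    forall (k : nat) (x0 : 'cV[R]_n),
      (sqrte 'E_P[(fun t => eucl_norm (state x0 (fun _ _ => 0) k t) ^+ 2)%R]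
        <= (a * eucl_norm x0 * lambda ^+ k)%:E)%E].

(* A(xi_(k2-1)) ... A(xi_(k1+1)) A(xi_k1), for k1 <= k2. *)
Definition transition (k1 k2 : nat) (t : T) : 'M[R]_n :=
  iteri (k2 - k1) (fun i M => sysA G (xi (k1 + i)%N t) *m M) 1%:M.

Definition h2_partial (K : nat) : \bar R :=
  ('E_P[(fun t => \tr ((sysD G (xi 0%N t))^T *m sysD G (xi 0%N t)))%R] +
   \sum_(1 <= k < K.+1)
     'E_P[(fun t => \tr ((sysB G (xi 0%N t))^T *m (transition 1 k t)^T
        *m (sysC G (xi k t))^T *m sysC G (xi k t)
        *m transition 1 k t *m sysB G (xi 0%N t)))%R])%E.

(* Extended-real valued: the limit of the nondecreasing sequence [h2_partial]
   always exists in [\bar R]; it is finite when [exp_stable2] holds and the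
   coefficients are square integrable. *)
Definition h2norm : \bar R := sqrte (limn h2_partial).

End systems.

(* Main.v *)
(** Write [L N = E[A^T N A]], [M = E[C^T C]] and [phi N = E[tr (B^T N B)]], all
    expectations being taken at [xi 0]. Since [x_k] and the impulse response
    are sums of products of functions of distinct [xi_i], independence yields
    [E|x_k|^2 = x0^T L^k(I) x0] and shows that the [k]-th term of the squared
    H2 norm is [phi (L^(k-1) M)]. What remains is linear algebra. If
    [Q - L Q - M > 0], then [L Q <= (1 - e) Q] for some [e > 0], hence geometric
    decay, and [\sum_k phi (L^k M) <= phi Q] by telescoping. Conversely the
    truncated series [Q = \sum_(k < K) L^k (M + delta I)], for [delta] small and
    then [K] large, satisfies [Q - L Q - M = delta I - L^K (M + delta I) > 0]. *)

Require Import Defs.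
From HB Require Import structures.
From mathcomp Require Import all_boot all_order all_algebra.
From mathcomp Require Import all_classical all_reals all_analysis.
From mathcomp Require Import measurable_realfun ring lra.
Set Implicit Arguments.
Unset Strict Implicit.
Unset Printing Implicit Defensive.
Import Order.TTheory GRing.Theory Num.Theory.
Import numFieldNormedType.Exports.
Local Open Scope classical_set_scope.
Local Open Scope ring_scope.

(** Only second moments of the coefficients are assumed, so every integrand is arranged as a product
    in which each [xi_i] occurs through two entries of one coefficient matrix; hence the inductions
    run on products of two entries of the state rather than on the state itself. Conditional
    expectations are avoided: dependence on the past alone is expressed by factorization against
    products of integrable functions of later variables, a property stable under sums and under
    multiplication by a function of the next variable. Averaging the latest factor turns a weight
    [N] into [L N], so [L] acts on weights. The shift [delta I] is there because [M] may be
    singular: without it neither [Q] nor the residual need be definite. Its cost is [delta] times a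
    sum of [phi (L^k I)], which stability bounds, and it is paid from the gap between [gamma^2] and
    the squared norm. Finally, the coefficients are arbitrary off the support, possibly
    non-measurable, so the argument is run for modified coefficients and carried back along an event
    of probability one. *)

(** * Expectations of real-valued functions *)

Section expectation_real.
Context d (T : measurableType d) (R : realType) (P : probability T R).
Implicit Types Y : T -> R.

Local Notation L1 f := (P.-integrable setT (EFin \o f)).

Lemma fine_expectation Y : fine 'E_P[Y] = \int[P]_t Y t.
Proof. by rewrite unlock. Qed.

Lemma Rintegral_probability_cst (c : R) : \int[P]_t c = c.
Proof.
rewrite -[RHS]/(fine c%:E) -[c%:E]mule1 -(probability_setT P).
by rewrite -integral_cst.
Qed.

Lemma expectation_Rintegral Y : L1 Y -> 'E_P[Y]%E = (\int[P]_t Y t)%:E.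
Proof.
by move=> iY; rewrite unlock /Rintegral fineK//; exact: integrable_fin_num.
Qed.

Lemma integrable_Rsum (I : Type) (s : seq I) (Y : I -> T -> R) :
  (forall i, L1 (Y i)) -> L1 (fun t => \sum_(i <- s) Y i t).
Proof.
move=> iY; have := @integrable_sum _ T R P setT measurableT I s xpredT
  (fun i t => (Y i t)%:E) (fun i _ => iY i).
by apply: eq_integrable => // t _ /=; rewrite sumEFin.
Qed.

Lemma Rintegral_sum (I : Type) (s : seq I) (Y : I -> T -> R) :
  (forall i, L1 (Y i)) ->
  \int[P]_t (\sum_(i <- s) Y i t) = \sum_(i <- s) \int[P]_t Y i t.
Proof.
move=> iY; elim: s => [|i s IH].
  by under eq_Rintegral do rewrite big_nil; rewrite big_nil /Rintegral integral0.
rewrite big_cons -IH -RintegralD//; last exact: integrable_Rsum.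
by apply: eq_Rintegral => t _; rewrite big_cons.
Qed.

Lemma integrable_sqr Y : measurable_fun setT Y ->
  ('E_P[(fun t => Y t ^+ 2)%R] < +oo)%E -> L1 (fun t => Y t ^+ 2).
Proof.
move=> mY; rewrite unlock => Y2; apply/integrableP; split.
  by apply/measurable_EFinP; exact: measurable_funX.
by under eq_integral do rewrite /= ger0_norm ?sqr_ge0//.
Qed.

(** The domination [|Y1 Y2| <= Y1^2 + Y2^2]; it makes products of two entries integrable when only
    their squares are assumed to be. *)
Lemma integrable_mul Y1 Y2 : measurable_fun setT Y1 -> measurable_fun setT Y2 ->
  L1 (fun t => Y1 t ^+ 2) -> L1 (fun t => Y2 t ^+ 2) ->
  L1 (fun t => Y1 t * Y2 t).
Proof.
move=> m1 m2 i1 i2; apply: le_integrable (integrableD measurableT i1 i2) => //.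
  by apply/measurable_EFinP; exact: measurable_funM.
move=> t _ /=; rewrite lee_fin normrM.
rewrite [leRHS]ger0_norm ?addr_ge0 ?sqr_ge0//.
rewrite -(real_normK (num_real (Y1 t))) -(real_normK (num_real (Y2 t))).
have := sqr_ge0 (`|Y1 t| - `|Y2 t|).
have := mulr_ge0 (normr_ge0 (Y1 t)) (normr_ge0 (Y2 t)).
by nra.
Qed.

End expectation_real.

(** * Products of functions of independent random elements *)

Section product_formula.
Import HBNNSimple.
Context d d' (T : measurableType d) (E : measurableType d') (R : realType).
Variable P : probability T R.
Implicit Types (g : E -> R) (f : nat -> E -> R) (Y : T -> R).

Local Notation L1 f := (P.-integrable setT (EFin \o f)).

(** Induction on the complexity of [f]: indicators by hypothesis, simple functions by linearity,
    then monotone convergence. [Y] stands for the other factors of the product. *)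
Lemma indic_factor_integral (X : {mfun T >-> E}) Y (c : R) :
    measurable_fun setT Y -> (forall t, 0 <= Y t) ->
    (forall U, measurable U ->
      \int[P]_t (Y t * \1_U (X t))%:E = c%:E * P (X @^-1` U))%E ->
  forall f : E -> R, measurable_fun setT f -> (forall x, 0 <= f x) ->
    (\int[P]_t (Y t * f (X t))%:E = c%:E * \int[P]_t (f (X t))%:E)%E.
Proof.
move=> mY Y0 YU f mf f0.
have mEf := (measurable_EFinP _ _).2 mf.
have mX : measurable_fun setT X by [].
pose h := @nnsfun_approx _ E R setT measurableT (EFin \o f) mEf.
have h_nd x : {homo h^~ x : m n / (m <= n)%N >-> m <= n}.
  by move=> m n mn; exact/lefP/nd_nnsfun_approx.
have h_cvg x : EFin \o h^~ x @ \oo --> (f x)%:E.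
  by apply: cvg_nnsfun_approx => // y _; rewrite lee_fin.
have mhX n : measurable_fun setT (h n \o X) by exact: measurableT_comp.
have step n :
    (\int[P]_t (Y t * h n (X t))%:E = c%:E * \int[P]_t (h n (X t))%:E)%E.
  (* On the range of [h n] one has [|y| = y]; the absolute value makes every summand non-negative
     without appeal to membership in [s]. *)
  have [s hE] : exists s : seq R, forall x,
      h n x = \sum_(y <- s) `|y| * \1_(h n @^-1` [set y]) x.
    exists (finmap.enum_fset (fset_set (range (h n)))) => x.
    rewrite (fimfunE (h n) x) fsbig_finite//= big_seq [RHS]big_seq.
    apply: eq_bigr => y.
    by rewrite in_fset_set// inE => -[z _ <-]; rewrite ger0_norm.
  have mU y : measurable (h n @^-1` [set y]) by [].
  have mUX y : measurable_fun setT (fun t => \1_(h n @^-1` [set y]) (X t) : R).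
    exact: (measurableT_comp (@measurable_indic _ E R setT _ (mU y)) mX).
  under eq_integral => t _.
    rewrite hE big_distrr/= -sumEFin.
    under eq_bigr do rewrite mulrCA.
    over.
  under [in RHS]eq_integral do rewrite hE -sumEFin.
  rewrite ge0_integral_sum//; last 2 first.
  - move=> y; apply/measurable_EFinP; apply: measurable_funM => //.
    exact: measurable_funM.
  - by move=> y t _; rewrite lee_fin !mulr_ge0.
  rewrite ge0_integral_sum//; last first.
    by move=> y; apply/measurable_EFinP; exact: measurable_funM.
  rewrite ge0_sume_distrr; last first.
    by move=> y _; apply: integral_ge0 => t _; rewrite lee_fin mulr_ge0.
  apply: eq_bigr => y _.
  under eq_integral do rewrite EFinM.
  rewrite ge0_integralZl//; last 2 first.
  - by apply/measurable_EFinP; exact: measurable_funM.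
  - by move=> t _; rewrite lee_fin mulr_ge0.
  rewrite YU// muleCA; congr (_ * _)%E.
  under eq_integral do rewrite EFinM.
  rewrite ge0_integralZl//; last exact/measurable_EFinP.
  congr (_ * _)%E.
  have -> : (fun t => (\1_(h n @^-1` [set y]) (X t) : R)%:E) =
            (fun t => (\1_(X @^-1` (h n @^-1` [set y])) t)%:E) by [].
  by rewrite integral_indic ?setIT// -[X in measurable X]setTI; exact: mX.
have lhs : (\int[P]_t (Y t * h n (X t))%:E @[n --> \oo] -->
    \int[P]_t (Y t * f (X t))%:E)%E.
  rewrite (_ : (fun t => (Y t * f (X t))%:E) =
    (fun t => limn (fun n => (Y t * h n (X t))%:E))); last first.
    apply/funext => t; apply/esym/cvg_lim => //.
    rewrite EFinM; under eq_fun do rewrite EFinM.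
    exact: (cvgeZl _ (h_cvg (X t))).
  apply: cvg_monotone_convergence => //.
  - by move=> n; apply/measurable_EFinP; exact: measurable_funM mY (mhX n).
  - by move=> n t _; rewrite lee_fin mulr_ge0.
  - by move=> t _ m n mn; rewrite lee_fin ler_wpM2l// h_nd.
have rhs : (\int[P]_t (h n (X t))%:E @[n --> \oo] --> \int[P]_t (f (X t))%:E)%E.
  rewrite (_ : (fun t => (f (X t))%:E) =
    (fun t => limn (fun n => (h n (X t))%:E))); last first.
    by apply/funext => t; apply/esym/cvg_lim => //; exact: h_cvg.
  apply: cvg_monotone_convergence => //.
  - by move=> n; apply/measurable_EFinP; exact: mhX.
  - by move=> n t _; rewrite lee_fin.
  - by move=> t _ m n mn; rewrite lee_fin h_nd.
suff rhs' : (\int[P]_t (Y t * h n (X t))%:E @[n --> \oo] -->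
    c%:E * \int[P]_t (f (X t))%:E)%E by exact: (cvg_unique _ lhs rhs').
under eq_cvg do rewrite step.
exact: cvgeZl.
Qed.

Variable X : nat -> {mfun T >-> E}.
Hypothesis X_indep : forall (J : seq nat) (U : nat -> set E),
  uniq J -> (forall k, measurable (U k)) ->
  P (\bigcap_(k in [set` J]) (X k @^-1` U k)) =
  (\prod_(k <- J) P (X k @^-1` U k))%E.

Lemma prod_indic_bigcap (J : seq nat) (U : nat -> set E) t :
  \prod_(k <- J) \1_(U k) (X k t) =
  \1_(\bigcap_(k in [set` J]) (X k @^-1` U k)) t :> R.
Proof.
elim: J => [|k J IH].
  by rewrite big_nil indicE mem_set// => i.
rewrite big_cons IH !indicE -natrM mulnb; congr (nat_of_bool _)%:R.
apply/andP/idP; rewrite !inE.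
  move=> [kU JU] i /=; rewrite inE => /orP[/eqP->//|]; exact: JU.
by move=> JU; split=> [|i iJ]; apply: JU => /=; rewrite inE ?eqxx// iJ orbT.
Qed.

(** The induction on [J1] turns one indicator at a time into a function: moving the index to [J2],
    with an arbitrary set there, supplies the hypothesis of [indic_factor_integral]. For empty [J1]
    the claim is independence itself. *)
Lemma indep_prod_mixed (J1 J2 : seq nat) (f : nat -> E -> R)
    (U : nat -> set E) :
    uniq (J1 ++ J2) -> (forall k, measurable (U k)) ->
    (forall k, measurable_fun setT (f k)) -> (forall k x, 0 <= f k x) ->
    (forall k, L1 (f k \o X k)) ->
  (\int[P]_t (\prod_(k <- J1) f k (X k t) * \prod_(k <- J2) \1_(U k) (X k t))%:E
   = (\prod_(k <- J1) \int[P]_t f k (X k t) *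
      \prod_(k <- J2) fine (P (X k @^-1` U k)))%:E)%E.
Proof.
have mXk k : measurable_fun setT (X k) by [].
move=> uJ mU mf f0 if_.
have mXU k (V : set E) : measurable V -> measurable (X k @^-1` V).
  by move=> mV; rewrite -[X in measurable X]setTI; exact: mXk.
elim: J1 J2 U mU uJ => [|k J1 IH] J2 U mU uJ.
  under eq_integral do rewrite big_nil mul1r prod_indic_bigcap.
  have -> : (\prod_(k <- [::]) \int[P]_t f k (X k t))%R = 1 by rewrite big_nil.
  rewrite integral_indic//; last first.
    by apply: bigcap_measurableType => // k _; exact: mXU.
  rewrite setIT mul1r; apply: (etrans (X_indep _ _)) => //.
  elim: J2 {uJ} => [|k J2 IH2]; first by rewrite !big_nil.
  by rewrite !big_cons IH2 EFinM fineK// fin_num_measure//; exact: mXU.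
have [kJ1 kJ2 uJ'] : [/\ k \notin J1, k \notin J2 & uniq (J1 ++ k :: J2)].
  move: uJ; rewrite cat_cons cons_uniq mem_cat negb_or -andbA.
  move=> /and3P[k1 k2 u].
  by split=> //; rewrite -cat1s uniq_catCA/= mem_cat negb_or k1 k2.
pose Y t := \prod_(k <- J1) f k (X k t) * \prod_(k <- J2) \1_(U k) (X k t).
pose c := \prod_(k <- J1) \int[P]_t f k (X k t) *
      \prod_(k <- J2) fine (P (X k @^-1` U k)).
transitivity (\int[P]_t (Y t * f k (X k t))%:E)%E.
  apply: eq_integral => t _; rewrite /Y big_cons; congr EFin; ring.
rewrite (@indic_factor_integral (X k) Y c)//.
- rewrite big_cons /Rintegral -(fineK (integrable_fin_num _ (if_ k)))// -EFinM.
  by rewrite /= /c; congr EFin; rewrite /Rintegral; ring.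
- apply: measurable_funM; apply: measurable_prod => i _.
    exact: (measurableT_comp (mf i)).
  exact: (measurableT_comp (@measurable_indic _ E R setT _ (mU i)) (mXk i)).
- by move=> t; rewrite mulr_ge0// prodr_ge0.
(* As [k] is not in [J2], [W] chooses the set at [k] freely and keeps the others. *)
- move=> V mV; pose W i := if i == k then V else U i.
  have mW i : measurable (W i) by rewrite /W; case: ifP.
  have WU i : i \in J2 -> W i = U i.
    by rewrite /W; case: eqP => // ->; rewrite (negbTE kJ2).
  have Wk : W k = V by rewrite /W eqxx.
  have W1 t : \prod_(j <- k :: J2) \1_(W j) (X j t) =
      \1_V (X k t) * \prod_(j <- J2) \1_(U j) (X j t) :> R.
    by rewrite big_cons Wk; congr *%R; apply: eq_big_seq => j jJ; rewrite WU.
  have WP : \prod_(j <- k :: J2) fine (P (X j @^-1` W j)) =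
      fine (P (X k @^-1` V)) * \prod_(j <- J2) fine (P (X j @^-1` U j)).
    by rewrite big_cons Wk; congr *%R; apply: eq_big_seq => j jJ; rewrite WU.
  have := IH (k :: J2) W mW uJ'; rewrite WP.
  under eq_integral do rewrite W1.
  move=> IHV; rewrite -(fineK (fin_num_measure P _ (mXU k V mV)))//= -EFinM.
  rewrite -[RHS]/((_ * _)%:E) /c.
  transitivity ((\prod_(k <- J1) \int[P]_t f k (X k t) *
    (fine (P (X k @^-1` V)) *
      \prod_(j <- J2) fine (P (X j @^-1` U j))))%:E)%E; last first.
    by congr EFin; ring.
  rewrite -IHV; apply: eq_integral => t _.
  by rewrite /Y; congr EFin; ring.
Qed.

Definition integrable_family f :=
  (forall k, measurable_fun setT (f k)) /\ (forall k, L1 (f k \o X k)).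

Definition fupd (f : nat -> E -> R) k g i := if i == k then g else f i.

Lemma integrable_family_upd f k g : integrable_family f ->
  measurable_fun setT g -> L1 (g \o X k) -> integrable_family (fupd f k g).
Proof.
by move=> [mf if_] mg ig; split=> i; rewrite /fupd; case: eqP => // ->.
Qed.

(** [F] is abstract so that one statement covers both the integrands and their integrals. *)
Lemma big_fupd (J : seq nat) f k g (F : nat -> (E -> R) -> R) : k \notin J ->
  \prod_(i <- J) F i (fupd f k g i) = \prod_(i <- J) F i (f i).
Proof.
move=> kJ; apply: eq_big_seq => i iJ; rewrite /fupd.
by case: eqP iJ kJ => // -> ->.
Qed.

Lemma measurable_prod_family (J : seq nat) f : integrable_family f ->
  measurable_fun setT (fun t => \prod_(k <- J) f k (X k t)).
Proof.
move=> [mf _]; apply: measurable_prod => i _.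
exact: (measurableT_comp (mf i) (measurable_funPT (X i))).
Qed.

Lemma ge0_indep_prod (J : seq nat) f : uniq J ->
    integrable_family f -> (forall k, k \in J -> forall x, 0 <= f k x) ->
  (\int[P]_t (\prod_(k <- J) f k (X k t))%:E =
   (\prod_(k <- J) \int[P]_t f k (X k t))%:E)%E.
Proof.
move=> uJ [mf if_] f0.
(* [indep_prod_mixed] wants non-negativity at every index, while [f] has it on [J] only; absolute
   values repair this without changing the product. *)
pose g k x : R := `|f k x|.
have gE k x : k \in J -> g k x = f k x by move=> kJ; rewrite /g ger0_norm ?f0.
have := @indep_prod_mixed J [::] g (fun _ => setT).
rewrite cats0 => /(_ uJ); rewrite big_nil mulr1 => H.
transitivity (\int[P]_t (\prod_(k <- J) g k (X k t) *
    \prod_(k <- [::]) \1_[set: E] (X k t))%:E)%E.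
  apply: eq_integral => t _; rewrite big_nil mulr1; congr EFin.
  by apply: eq_big_seq => k kJ; rewrite gE.
rewrite H//.
- congr EFin; apply: eq_big_seq => k kJ.
  by apply: eq_Rintegral => t _; rewrite gE.
- by move=> k; apply: measurableT_comp.
- by move=> k x; rewrite /g normr_ge0.
- by move=> k; exact: integrable_norm (if_ k).
Qed.

(** The absolute value of the product is a product of absolute values, whose integral is a real
    number by the non-negative case. *)
Lemma integrable_indep_prod (J : seq nat) f : uniq J ->
  integrable_family f -> L1 (fun t => \prod_(k <- J) f k (X k t)).
Proof.
move=> uJ ff; have [mf if_] := ff.
apply/integrableP; split.
  by apply/measurable_EFinP; exact: measurable_prod_family.
under eq_integral do rewrite /= normr_prod.
pose g k x : R := `|f k x|.
have := @ge0_indep_prod J g uJ; rewrite /g => ->//; first exact: ltry.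
split=> k; first by apply: measurableT_comp.
exact: integrable_norm (if_ k).
Qed.

(** Signs are removed one index at a time: the factor at [k] splits into positive and negative
    parts, and each of them joins the list [J2] of non-negative factors. Integrability of both
    products allows the integrals to be subtracted. *)
Lemma indep_prod (J : seq nat) f : uniq J ->
    integrable_family f ->
  \int[P]_t (\prod_(k <- J) f k (X k t)) = \prod_(k <- J) \int[P]_t f k (X k t).
Proof.
have main J1 : forall J2 (g : nat -> E -> R),
    uniq (J1 ++ J2) -> integrable_family g ->
    (forall k, k \in J2 -> forall x, 0 <= g k x) ->
    \int[P]_t (\prod_(k <- J1 ++ J2) g k (X k t)) =
    \prod_(k <- J1 ++ J2) \int[P]_t g k (X k t).
  elim: J1 => [|k J1 IH] J2 g uJ fg g0.
    by rewrite /Rintegral ge0_indep_prod.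
  have [mg ig] := fg.
  have kN : k \notin J1 ++ J2 by move: uJ; rewrite cat_cons => /andP[].
  have [kJ1 kJ2] : k \notin J1 /\ k \notin J2.
    by apply/andP; rewrite -negb_or -mem_cat.
  have uJ' : uniq (J1 ++ k :: J2) by rewrite -cat1s uniq_catCA.
  have part h : measurable_fun setT h -> L1 (h \o X k) ->
      (forall x, 0 <= h x) ->
      \int[P]_t (h (X k t) * \prod_(i <- J1 ++ J2) g i (X i t)) =
      \int[P]_t h (X k t) * \prod_(i <- J1 ++ J2) \int[P]_t g i (X i t).
    move=> mh ih h0.
    have pE (F : nat -> (E -> R) -> R) :
        \prod_(i <- J1 ++ k :: J2) F i (fupd g k h i) =
        F k h * \prod_(i <- J1 ++ J2) F i (g i).
      rewrite -(big_fupd _ h _ kN) !big_cat big_cons/= {2}/fupd eqxx; ring.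
    have := IH (k :: J2) (fupd g k h) uJ' (integrable_family_upd fg mh ih).
    rewrite (pE (fun i u => \int[P]_t u (X i t))) => <-.
      by apply: eq_Rintegral => t _; rewrite (pE (fun i u => u (X i t))).
    move=> i; rewrite inE /fupd; case: eqP => [_ _ //|_ /=]; exact: g0.
  have gpm x : g k x = (g k)^\+ x - (g k)^\- x.
    by rewrite -[in LHS](funrposBneg (g k)).
  have iprod h : measurable_fun setT h -> L1 (h \o X k) ->
      L1 (fun t => h (X k t) * \prod_(i <- J1 ++ J2) g i (X i t)).
    move=> mh ih.
    have := integrable_indep_prod uJ (integrable_family_upd fg mh ih).
    apply: eq_integrable => // t _ /=; rewrite big_cons {1}/fupd eqxx.
    by rewrite (big_fupd _ _ (fun i u => u (X i t)) kN).
  have mp := measurable_funrpos (mg k).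
  have mn := measurable_funrneg (mg k).
  have ip : L1 ((g k)^\+ \o X k) by exact: integrable_funrpos (ig k).
  have in_ : L1 ((g k)^\- \o X k) by exact: integrable_funrneg (ig k).
  rewrite cat_cons big_cons.
  under eq_Rintegral do rewrite big_cons gpm mulrBl.
  rewrite RintegralB//; last 2 first.
  - exact: iprod.
  - exact: iprod.
  rewrite (part _ mp ip); last by move=> x; exact: funrpos_ge0.
  rewrite (part _ mn in_); last by move=> x; exact: funrneg_ge0.
  by under [in RHS]eq_Rintegral do rewrite gpm; rewrite RintegralB// mulrBl.
by move=> uJ ff; have := main J [::] f; rewrite cats0; exact.
Qed.

(* [Y] behaves as if it were a function of [X 0, ..., X k.-1]. *)
Definition indep_of_future k Y := forall J f,
  uniq J -> all (leq k) J -> integrable_family f ->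
  L1 (fun t => Y t * \prod_(i <- J) f i (X i t)) /\
  \int[P]_t (Y t * \prod_(i <- J) f i (X i t)) =
  \int[P]_t Y t * \prod_(i <- J) \int[P]_t f i (X i t).

(** A filler, for when only the values of a family at one index, or at none, matter. *)
Lemma integrable_family0 : integrable_family (fun _ => cst 0).
Proof.
split=> k; first exact: measurable_cst.
exact: integrable0.
Qed.

Lemma indep_of_future_integrable k Y : indep_of_future k Y -> L1 Y.
Proof.
move=> /(_ [::] _ isT isT integrable_family0)[+ _].
by under eq_fun do rewrite big_nil mulr1.
Qed.

Lemma eq_indep_of_future k Y Y' : Y =1 Y' ->
  indep_of_future k Y -> indep_of_future k Y'.
Proof. by move=> /funext ->. Qed.

Lemma indep_of_future_cst k c : indep_of_future k (cst c).
Proof.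
move=> J f uJ _ ff; have iJ := integrable_indep_prod uJ ff.
split.
  exact: (integrableZl measurableT c iJ).
rewrite RintegralZl// indep_prod//; congr *%R.
exact/esym/Rintegral_probability_cst.
Qed.

Lemma indep_of_futureD k Y Y' : indep_of_future k Y -> indep_of_future k Y' ->
  indep_of_future k (fun t => Y t + Y' t).
Proof.
move=> pY pY' J f uJ kJ ff.
have [i1 e1] := pY J f uJ kJ ff; have [i2 e2] := pY' J f uJ kJ ff.
split.
  apply: eq_integrable (integrableD measurableT i1 i2) => // t _ /=.
  by rewrite -EFinD mulrDl.
have iY := indep_of_future_integrable pY.
have iY' := indep_of_future_integrable pY'.
rewrite (RintegralD measurableT iY iY') mulrDl -e1 -e2 -RintegralD//.
by apply: eq_Rintegral => t _; rewrite mulrDl.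
Qed.

Lemma indep_of_future_sum (I : Type) (s : seq I) k (Y : I -> T -> R) :
  (forall i, indep_of_future k (Y i)) ->
  indep_of_future k (fun t => \sum_(i <- s) Y i t).
Proof.
move=> pY; elim: s => [|i s IH].
  by under [X in indep_of_future _ X]eq_fun do rewrite big_nil;
    exact: indep_of_future_cst.
by under [X in indep_of_future _ X]eq_fun do rewrite big_cons;
  exact: indep_of_futureD.
Qed.

(** The factor at time [k] is absorbed into the test product, which becomes one over [k :: J]; since
    [J] starts after [k], this list is still duplicate free. *)
Lemma indep_of_futureM k Y g : indep_of_future k Y ->
    measurable_fun setT g -> L1 (g \o X k) ->
  indep_of_future k.+1 (fun t => Y t * g (X k t)) /\
  \int[P]_t (Y t * g (X k t)) = \int[P]_t Y t * \int[P]_t g (X k t).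
Proof.
move=> pY mg ig.
have YgE : \int[P]_t (Y t * g (X k t)) = \int[P]_t Y t * \int[P]_t g (X k t).
  have [] := pY [:: k] (fupd (fun _ => cst 0) k g) isT.
  - by rewrite /= leqnn.
  - exact: integrable_family_upd integrable_family0 mg ig.
  move=> _; rewrite big_seq1 /fupd eqxx => <-.
  by apply: eq_Rintegral => t _; rewrite big_seq1 eqxx.
split=> // J f uJ kJ ff.
have kN : k \notin J.
  by apply/negP => /(allP kJ); rewrite ltnn.
have pE (F : nat -> (E -> R) -> R) :
    \prod_(i <- k :: J) F i (fupd f k g i) = F k g * \prod_(i <- J) F i (f i).
  by rewrite big_cons (big_fupd _ _ _ kN) /fupd eqxx.
have [] := pY (k :: J) (fupd f k g).
- by rewrite /= kN.
- by rewrite /= leqnn; apply: sub_all kJ => i; exact: ltnW.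
- exact: integrable_family_upd.
rewrite (pE (fun i u => \int[P]_t u (X i t))).
have EY t : Y t * \prod_(i <- k :: J) fupd f k g i (X i t) =
    Y t * g (X k t) * \prod_(i <- J) f i (X i t).
  by rewrite (pE (fun i u => u (X i t))) mulrA.
by rewrite (funext EY) => i1 ->; rewrite YgE mulrA.
Qed.

End product_formula.

(** * Second moments of linear recursions with independent coefficients *)

Section second_moments.
Context d d' (T : measurableType d) (E : measurableType d') (R : realType).
Variable P : probability T R.
Variable X : nat -> {mfun T >-> E}.
Hypothesis X_indep : forall (J : seq nat) (U : nat -> set E),
  uniq J -> (forall k, measurable (U k)) ->
  P (\bigcap_(k in [set` J]) (X k @^-1` U k)) =
  (\prod_(k <- J) P (X k @^-1` U k))%E.
Hypothesis X_id : forall k (U : set E), measurable U ->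
  P (X k @^-1` U) = P (X 0%N @^-1` U).

Local Notation L1 f := (P.-integrable setT (EFin \o f)).

Lemma ge0_integral_id k (g : E -> \bar R) : measurable_fun setT g ->
  (forall x, 0 <= g x)%E ->
  (\int[P]_t g (X k t) = \int[P]_t g (X 0%N t))%E.
Proof.
move=> mg g0; rewrite -!(ge0_integral_distribution _ mg g0).
by apply: eq_measure_integral => U mU _; exact: X_id.
Qed.

Lemma integrable_id k (g : E -> R) : measurable_fun setT g ->
  L1 (g \o X 0%N) -> L1 (g \o X k).
Proof.
move=> mg /integrableP[_ fin]; apply/integrableP; split.
  by apply/measurable_EFinP; exact: measurableT_comp.
rewrite (@ge0_integral_id k (fun x => `|(g x)%:E|%E))//.
by apply: measurableT_comp => //; exact/measurable_EFinP.
Qed.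

Lemma Rintegral_id k (g : E -> R) : measurable_fun setT g ->
  L1 (g \o X 0%N) -> \int[P]_t g (X k t) = \int[P]_t g (X 0%N t).
Proof.
move=> mg ig; have mEg := (measurable_EFinP _ _).2 mg.
have := integral_distribution mEg (integrable_id k mg ig).
have := integral_distribution mEg ig.
rewrite /Rintegral /= => <- <-; congr fine.
by apply: eq_measure_integral => U mU _; exact: X_id.
Qed.

Definition mx_integrable p q (H : E -> 'M[R]_(p, q)) := forall i j,
  measurable_fun setT (fun x => H x i j) /\ L1 (fun t => H (X 0%N t) i j).

Definition mx_sqr_integrable p q (F : E -> 'M[R]_(p, q)) := forall i j,
  measurable_fun setT (fun x => F x i j) /\
  L1 (fun t => F (X 0%N t) i j ^+ 2).

Lemma mx_sqr_integrableM p q (F : E -> 'M[R]_(p, q)) i j i' j' :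
  mx_sqr_integrable F ->
  measurable_fun setT (fun x => F x i j * F x i' j') /\
  L1 (fun t => F (X 0%N t) i j * F (X 0%N t) i' j').
Proof.
move=> FF; have [m1 i1] := FF i j; have [m2 i2] := FF i' j'.
split; first exact: measurable_funM.
apply: integrable_mul => //.
- exact: (measurableT_comp m1 (measurable_funPT (X 0%N))).
- exact: (measurableT_comp m2 (measurable_funPT (X 0%N))).
Qed.

Lemma congruence_entry p q (F : 'M[R]_(p, q)) (N : 'M[R]_p) i j :
  (F^T *m N *m F) i j = \sum_a \sum_b N a b * (F a i * F b j).
Proof.
rewrite exchange_big/= mxE; apply: eq_bigr => b _.
rewrite !mxE big_distrl/=; apply: eq_bigr => a _; rewrite !mxE; ring.
Qed.

Lemma trace_congruence p q (F : 'M[R]_(p, q)) (N : 'M[R]_p) :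
  \tr (F^T *m N *m F) = \sum_a \sum_b (\sum_c F a c * F b c) * N a b.
Proof.
rewrite /mxtrace; under eq_bigr do rewrite congruence_entry.
rewrite exchange_big/=; apply: eq_bigr => a _.
rewrite exchange_big/=; apply: eq_bigr => b _.
by rewrite big_distrl/=; apply: eq_bigr => c _; rewrite mulrC.
Qed.

Lemma mx_integrable_congruence p q (F : E -> 'M[R]_(p, q)) (N : 'M[R]_p) :
  mx_sqr_integrable F -> mx_integrable (fun x => (F x)^T *m N *m F x).
Proof.
move=> FF i j; split.
  under eq_fun do rewrite congruence_entry.
  apply: measurable_sum => a; apply: measurable_sum => b.
  by apply: measurable_funM => //; case: (mx_sqr_integrableM a i b j FF).
under eq_fun do rewrite congruence_entry.
apply: integrable_Rsum => a; apply: integrable_Rsum => b.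
have [_ iab] := mx_sqr_integrableM a i b j FF.
exact: (integrableZl measurableT (N a b) iab).
Qed.

(** The common form of the operators of the overview: [L] for the coefficient A, [M] for C at the
    identity, and [phi] for B after taking the trace. *)
Definition mean_congruence p q (F : E -> 'M[R]_(p, q)) (N : 'M[R]_p) :
    'M[R]_q :=
  mx_expectation P (fun t => (F (X 0%N t))^T *m N *m F (X 0%N t)).

Lemma mean_congruenceE p q (F : E -> 'M[R]_(p, q)) (N : 'M[R]_p) i j :
  mx_sqr_integrable F ->
  mean_congruence F N i j =
  \sum_a \sum_b N a b * \int[P]_t (F (X 0%N t) a i * F (X 0%N t) b j).
Proof.
move=> FF; have iab a b := (mx_sqr_integrableM a i b j FF).2.
have ZL a b := integrableZl measurableT (N a b) (iab a b).
rewrite mxE fine_expectation.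
under eq_Rintegral do rewrite congruence_entry.
rewrite Rintegral_sum; last first.
  by move=> a; apply: integrable_Rsum => b; exact: ZL.
apply: eq_bigr => a _; rewrite Rintegral_sum; last by move=> b; exact: ZL.
by apply: eq_bigr => b _; rewrite RintegralZl.
Qed.

(** By [trace_congruence], [V] enters the second moments only through products of two entries of the
    same column. *)
Definition products_indep_of_future k p q (V : T -> 'M[R]_(p, q)) :=
  forall a b c, indep_of_future P X k (fun t => V t a c * V t b c).

(** The trace is a sum of terms [W a b t * H (X k t) a b] with [W] determined by the past, so each
    entry of [H] may be replaced by its mean. This plays the role of conditioning on the past of
    [k]. *)
Lemma expectation_trace_congruence k p q (V : T -> 'M[R]_(p, q))
    (H : E -> 'M[R]_p) :
  products_indep_of_future k V -> mx_integrable H ->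
  let Y t := \tr ((V t)^T *m H (X k t) *m V t) in
  let Hm := mx_expectation P (fun t => H (X 0%N t)) in
  L1 Y /\ \int[P]_t Y t = \int[P]_t \tr ((V t)^T *m Hm *m V t).
Proof.
move=> pV iH Y Hm.
pose W a b t := \sum_c V t a c * V t b c.
have pW a b : indep_of_future P X k (W a b).
  by apply: indep_of_future_sum => // c; exact: pV.
have HM a b : indep_of_future P X k.+1 (fun t => W a b t * H (X k t) a b) /\
    \int[P]_t (W a b t * H (X k t) a b) = \int[P]_t W a b t * Hm a b.
  have [mab iab] := iH a b.
  have [fI ->] := indep_of_futureM (pW a b) mab (integrable_id k mab iab).
  split; [exact: fI|congr *%R].
  by rewrite (Rintegral_id k mab iab) mxE fine_expectation.
have iWH a b : L1 (fun t => W a b t * H (X k t) a b).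
  exact: indep_of_future_integrable (HM a b).1.
have iWm a b : L1 (fun t => W a b t * Hm a b).
  have iW := indep_of_future_integrable (pW a b).
  exact: (integrableZr measurableT (Hm a b) iW).
split; rewrite /Y.
  by under eq_fun do rewrite trace_congruence;
    apply: integrable_Rsum => a; apply: integrable_Rsum => b; exact: iWH.
under eq_Rintegral do rewrite trace_congruence.
under [RHS]eq_Rintegral do rewrite trace_congruence.
rewrite Rintegral_sum; last first.
  by move=> a; apply: integrable_Rsum => b; exact: iWH.
rewrite [RHS]Rintegral_sum; last first.
  by move=> a; apply: integrable_Rsum => b; exact: iWm.
apply: eq_bigr => a _.
rewrite Rintegral_sum; last by move=> b; exact: iWH.
rewrite [RHS]Rintegral_sum; last by move=> b; exact: iWm.
apply: eq_bigr => b _.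
by rewrite (HM a b).2 RintegralZr//; exact: indep_of_future_integrable (pW a b).
Qed.

(** A product of two entries of [F V] in one column is a sum of such products for [V], each times
    two entries of [F]; the latter are integrable because [F] is square integrable. *)
Lemma products_indep_of_futureM k n q (V : T -> 'M[R]_(n, q))
    (F : E -> 'M[R]_n) :
  products_indep_of_future k V -> mx_sqr_integrable F ->
  products_indep_of_future k.+1 (fun t => F (X k t) *m V t).
Proof.
move=> pV FF a b c.
pose Y i j t := V t i c * V t j c * (F (X k t) a i * F (X k t) b j).
apply: (@eq_indep_of_future _ _ _ _ _ P X _ (fun t => \sum_i \sum_j Y i j t)).
  move=> t; rewrite !mxE big_distrlr/=; apply: eq_bigr => i _.
  by apply: eq_bigr => j _; rewrite /Y; ring.
apply: indep_of_future_sum => // i; apply: indep_of_future_sum => // j.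
have [mF iF] := mx_sqr_integrableM a i b j FF.
exact: (indep_of_futureM (pV i j c) mF (integrable_id k mF iF)).1.
Qed.

(** One time step is traded for one application of the mean operator to the weight. *)
Lemma expectation_step k n q (V : T -> 'M[R]_(n, q)) (F : E -> 'M[R]_n) N :
  products_indep_of_future k V -> mx_sqr_integrable F ->
  \int[P]_t \tr ((F (X k t) *m V t)^T *m N *m (F (X k t) *m V t)) =
  \int[P]_t \tr ((V t)^T *m mean_congruence F N *m V t).
Proof.
move=> pV FF; have iH := mx_integrable_congruence N FF.
have [_ <-] := expectation_trace_congruence pV iH.
by apply: eq_Rintegral => t _; rewrite trmx_mul !mulmxA.
Qed.

End second_moments.

(** * Lyapunov inequalities *)

Section quadratic_forms.
Context (R : realType) (n : nat).
Implicit Types (N M : 'M[R]_n) (x y : 'cV[R]_n).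

Definition qform N x : R := (x^T *m N *m x) 0 0.

Lemma qformD N M x : qform (N + M) x = qform N x + qform M x.
Proof. by rewrite /qform mulmxDr mulmxDl mxE. Qed.

Lemma qformZ a N x : qform (a *: N) x = a * qform N x.
Proof. by rewrite /qform -scalemxAr -scalemxAl mxE. Qed.

Lemma qformB N M x : qform (N - M) x = qform N x - qform M x.
Proof. by rewrite -scaleN1r qformD qformZ mulN1r. Qed.

Lemma qform1 x : qform 1%:M x = \sum_i x i 0 ^+ 2.
Proof.
by rewrite /qform mulmx1 mxE; apply: eq_bigr => i _; rewrite mxE.
Qed.

Lemma qform1_ge0 x : 0 <= qform 1%:M x.
Proof. by rewrite qform1 sumr_ge0// => i _; exact: sqr_ge0. Qed.

Lemma qform1_gt0 x : x != 0 -> 0 < qform 1%:M x.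
Proof.
move=> x0; rewrite lt_neqAle qform1_ge0 andbT eq_sym.
apply: contraNN x0; rewrite qform1 psumr_eq0; last first.
  by move=> i _; exact: sqr_ge0.
move=> /allP x0; apply/eqP/colP => i; apply/eqP; rewrite mxE.
by have := x0 i; rewrite mem_index_enum sqrf_eq0 => /(_ isT).
Qed.

(** With [a = qform N y] and [b = x^T N y], and [N] symmetric, this is the computation behind
    Cauchy-Schwarz. *)
Lemma qform_combine N a x b y : qform N (a *: x - b *: y) =
  a ^+ 2 * qform N x - a * b * (x^T *m N *m y) 0 0
  - a * b * (y^T *m N *m x) 0 0 + b ^+ 2 * qform N y.
Proof.
rewrite /qform; have -> : (a *: x - b *: y)^T = a *: x^T - b *: y^T.
  by apply/matrixP => i j; rewrite !mxE.
rewrite !mulmxBr !mulmxBl -!scalemxAr -!scalemxAl.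
move: (x^T *m N *m x) (x^T *m N *m y) (y^T *m N *m x) (y^T *m N *m y) => r s t u.
rewrite !mxE; ring.
Qed.

Definition psdmx N := N^T = N /\ forall x, 0 <= qform N x.
Definition psdle N M := psdmx (M - N).

Lemma posdef_psd N : posdefmx N -> psdmx N.
Proof.
move=> [sN pN]; split=> // x; have [->|/pN/ltW//] := eqVneq x 0.
by rewrite /qform mulmx0 mxE.
Qed.

Lemma psdmxD N M : psdmx N -> psdmx M -> psdmx (N + M).
Proof.
move=> [sN pN] [sM pM]; split=> [|x]; first by rewrite linearD/= sN sM.
by rewrite qformD addr_ge0.
Qed.

Lemma psdmxZ a N : 0 <= a -> psdmx N -> psdmx (a *: N).
Proof.
move=> a0 [sN pN]; split=> [|x]; first by rewrite linearZ/= sN.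
by rewrite qformZ mulr_ge0.
Qed.

Lemma psdmx0 : psdmx 0.
Proof. by split=> [|x]; rewrite ?trmx0// /qform mulmx0 mul0mx mxE. Qed.

Lemma psdmx1 : psdmx 1%:M.
Proof. by split=> [|x]; [exact: trmx1|exact: qform1_ge0]. Qed.

Lemma psdle_trans N M K : psdle N M -> psdle M K -> psdle N K.
Proof. by rewrite /psdle => /psdmxD/[apply]; rewrite addrC addrA subrK. Qed.

Lemma psdleZ a N M : 0 <= a -> psdle N M -> psdle (a *: N) (a *: M).
Proof. by rewrite /psdle -scalerBr; exact: psdmxZ. Qed.

Lemma psdle_qform N M x : psdle N M -> qform N x <= qform M x.
Proof. by move=> [_ /(_ x)]; rewrite qformB subr_ge0. Qed.

Lemma psdle_qformP N M : psdmx N -> psdmx M ->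
  (forall x, qform N x <= qform M x) -> psdle N M.
Proof.
move=> [sN _] [sM _] NM; split=> [|x]; first by rewrite linearB/= sN sM.
by rewrite qformB subr_ge0.
Qed.

(* In the inner product given by [N], [x i 0] is the product of [x] with
   [invmx N *m delta_mx i 0], so that Cauchy-Schwarz bounds it. *)
Lemma posdef_coercive N : posdefmx N ->
  exists2 c, 0 < c & psdle 1%:M (c *: N).
Proof.
move=> pN; have [sN qN] := pN.
have uN : N \in unitmx.
  rewrite -row_free_unit -kermx_eq0; apply/rowV0P => u /sub_kermxP uN0.
  apply/eqP; apply: contraT => u0.
  have uT0 : u^T != 0.
    by apply: contraNN u0 => /eqP/(congr1 trmx); rewrite trmxK trmx0 => ->.
  by have := qN _ uT0; rewrite trmxK uN0 mul0mx mxE ltxx.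
pose y i : 'cV[R]_n := invmx N *m delta_mx i 0.
have y0 i : y i != 0.
  apply/eqP => /(congr1 (mulmx N)); rewrite mulKVmx// mulmx0 => /matrixP/(_ i 0).
  by rewrite !mxE !eqxx/= => /eqP; rewrite oner_eq0.
have qy i : 0 < qform N (y i) by exact: qN.
have xi_le x i : x i 0 ^+ 2 <= qform N (y i) * qform N x.
  have := (posdef_psd pN).2 (qform N (y i) *: x - x i 0 *: y i).
  have -> : qform N (qform N (y i) *: x - x i 0 *: y i) =
      qform N (y i) * (qform N (y i) * qform N x - x i 0 ^+ 2).
    have Ny : N *m y i = delta_mx i 0 by rewrite mulKVmx.
    have xNy : (x^T *m N *m y i) 0 0 = x i 0.
      by rewrite -mulmxA Ny -colE !mxE.
    have yNx : ((y i)^T *m N *m x) 0 0 = x i 0.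
      have <- : (x^T *m N *m y i)^T 0 0 = x i 0 by rewrite mxE.
      by rewrite !trmx_mul trmxK sN mulmxA.
    rewrite qform_combine xNy yNx; ring.
  by rewrite pmulr_rge0// subr_ge0.
(* The [+ 1] keeps the constant positive when [n = 0]. *)
exists (\sum_i qform N (y i) + 1).
  by rewrite ltr_wpDl// sumr_ge0// => i _; exact: ltW.
apply: psdle_qformP; first exact: psdmx1.
  apply: psdmxZ (posdef_psd pN).
  by rewrite addr_ge0// sumr_ge0// => i _; exact: ltW.
move=> x; rewrite qformZ mulrDl mul1r qform1 ler_wpDr ?(posdef_psd pN).2//.
by rewrite mulr_suml ler_sum.
Qed.

(** Entrywise, [|x_i x_j| <= |x|^2], which follows from the squares of [x_i - x_j] and [x_i + x_j].
    The [+ 1] covers [N = 0]. *)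
Lemma psd_bounded N : psdmx N -> exists2 c, 0 < c & psdle N (c *: 1%:M).
Proof.
move=> pN; exists (\sum_i \sum_j `|N i j| + 1).
  by rewrite ltr_wpDl// sumr_ge0// => i _; rewrite sumr_ge0.
apply: psdle_qformP => //.
  apply: psdmxZ psdmx1.
  by rewrite addr_ge0// sumr_ge0// => i _; rewrite sumr_ge0.
move=> x; rewrite qformZ mulrDl mul1r ler_wpDr ?qform1_ge0//.
have xx i : x i 0 ^+ 2 <= qform 1%:M x.
  by rewrite qform1 (bigD1 i)//= lerDl sumr_ge0// => j _; exact: sqr_ge0.
rewrite /qform congruence_entry mulr_suml ler_sum// => i _.
rewrite mulr_suml ler_sum// => j _; apply: le_trans (ler_norm _) _.
rewrite normrM ler_wpM2l// -/(qform _ _) ler_norml.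
have := xx i; have := xx j; have := sqr_ge0 (x i 0 - x j 0).
have := sqr_ge0 (x i 0 + x j 0); move: (qform _ _) => s.
by move=> h1 h2 h3 h4; apply/andP; split; nra.
Qed.

End quadratic_forms.

(** * Lyapunov inequalities for a positive linear map *)

Section lyapunov.
Context (R : realType) (n : nat) (L : {linear 'M[R]_n -> 'M[R]_n}).
Hypothesis L_psd : forall N, psdmx N -> psdmx (L N).
Variable phi : {scalar 'M[R]_n}.
Hypothesis phi_psd : forall N, psdmx N -> 0 <= phi N.
Variable M : 'M[R]_n.
Hypothesis M_psd : psdmx M.
Implicit Types N Q : 'M[R]_n.

Lemma iter_linear k a N N' :
  iter k L (a *: N + N') = a *: iter k L N + iter k L N'.
Proof. by elim: k => //= k ->; rewrite linearP. Qed.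

Lemma iterZ k a N : iter k L (a *: N) = a *: iter k L N.
Proof.
have i0 : iter k L 0 = 0 by elim: k => //= k ->; rewrite linear0.
by have := iter_linear k a N 0; rewrite !addr0 i0 addr0.
Qed.

Lemma iterB k N N' : iter k L (N - N') = iter k L N - iter k L N'.
Proof. by rewrite addrC -scaleN1r iter_linear scaleN1r addrC. Qed.

Lemma iterD k N N' : iter k L (N + N') = iter k L N + iter k L N'.
Proof. by rewrite -[N in LHS]scale1r iter_linear scale1r. Qed.

Lemma iter_psd k N : psdmx N -> psdmx (iter k L N).
Proof. by move=> pN; elim: k => //= k; exact: L_psd. Qed.

Lemma iter_psdle k N N' : psdle N N' -> psdle (iter k L N) (iter k L N').
Proof. by rewrite /psdle -iterB; exact: iter_psd. Qed.

Lemma phi_psdle N N' : psdle N N' -> phi N <= phi N'.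
Proof. by move=> /phi_psd; rewrite linearB subr_ge0. Qed.

Lemma lyapunov_decay Q : posdefmx Q -> posdefmx (Q - L Q - M) ->
  exists a lambda : R, [/\ 0 < a, 0 < lambda, lambda < 1 &
    forall k, psdle (iter k L 1%:M) ((a * lambda ^+ k) *: 1%:M)].
Proof.
move=> pQ pS; set S := Q - L Q - M in pS.
have [c c0 cS] := posdef_coercive pS.
have [c3 c30 c3Q] := posdef_coercive pQ.
have [c2 c20 c2Q] := psd_bounded (posdef_psd pQ).
(* From [Q <= c2 I] and [I <= c S] one gets [Q <= c c2 S], hence [e Q <= S]; the [+ 1] gives
   [e < 1], so that the rate [1 - e] is positive. *)
pose e := (c * c2 + 1)^-1.
have c1 : 0 < c * c2 + 1 by rewrite ltr_wpDl// mulr_ge0// ltW.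
have e0 : 0 < e by rewrite invr_gt0.
have eQS : psdle (e *: Q) S.
  apply: psdle_qformP; [exact: psdmxZ (ltW e0) (posdef_psd pQ)|
    exact: posdef_psd|].
  move=> x; rewrite qformZ mulrC ler_pdivrMr//.
  apply: le_trans (psdle_qform x c2Q) _; rewrite qformZ.
  have := psdle_qform x cS; rewrite qformZ => h.
  have := (posdef_psd pS).2 x; nra.
have e1 : e < 1.
  by rewrite invf_lt1// ltrDr mulr_gt0.
have step : psdle (L Q) ((1 - e) *: Q).
  rewrite /psdle (_ : _ - _ = (S - e *: Q) + M); first exact: psdmxD.
  by apply/matrixP => i j; rewrite /S !mxE; ring.
have decay k : psdle (iter k L Q) ((1 - e) ^+ k *: Q).
  elim: k => [|k IH].
    by rewrite expr0 scale1r /psdle subrr; exact: psdmx0.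
  rewrite iterSr; apply: psdle_trans (iter_psdle k step) _.
  by rewrite iterZ exprS -scalerA; apply: psdleZ => //; rewrite subr_ge0 ltW.
(* The identity is compared with [Q] twice: [I <= c3 Q] before iterating and [Q <= c2 I]
   afterwards. *)
exists (c3 * c2), (1 - e); split; rewrite ?mulr_gt0 ?subr_gt0//.
  by rewrite ltrBlDr ltrDl.
move=> k; apply: psdle_trans (iter_psdle k c3Q) _.
rewrite iterZ -!mulrA -scalerA; apply: psdleZ; first exact: ltW.
apply: psdle_trans (decay k) _.
rewrite mulrC -scalerA; apply: psdleZ => //.
by rewrite exprn_ge0// subr_ge0 ltW.
Qed.

Lemma lyapunov_telescope Q K : posdefmx Q -> posdefmx (Q - L Q - M) ->
  \sum_(k < K) phi (iter k L M) <= phi Q.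
Proof.
move=> pQ pS.
(* Keeping the non-negative remainder [phi (L^K Q)] makes the induction work: by [M <= Q - L Q],
   each new term is at most the drop of this remainder. *)
suff : \sum_(k < K) phi (iter k L M) <= phi Q - phi (iter K L Q).
  move=> /le_trans; apply; rewrite lerBlDr lerDl.
  exact/phi_psd/iter_psd/posdef_psd.
elim: K => [|K IH]; first by rewrite big_ord0 /= subrr.
rewrite big_ord_recr/=.
have : phi (iter K L M) <= phi (iter K L Q) - phi (iter K L (L Q)).
  by rewrite -linearB -iterB; apply/phi_psdle/iter_psdle/posdef_psd.
rewrite -iterSr /= => h; apply: le_trans (lerD IH h) _.
by rewrite addrA subrK.
Qed.

Lemma lyapunov_exists (a lambda h eta : R) :
    0 < a -> 0 < lambda -> lambda < 1 -> 0 < eta ->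
    (forall k, psdle (iter k L 1%:M) ((a * lambda ^+ k) *: 1%:M)) ->
    (forall K, \sum_(k < K) phi (iter k L M) <= h) ->
  exists Q, [/\ posdefmx Q, posdefmx (Q - L Q - M) & phi Q < h + eta].
Proof.
move=> a0 l0 l1 eta0 decay hM.
have l1' : 0 < 1 - lambda by rewrite subr_gt0.
have phi1 : 0 <= phi 1%:M by exact/phi_psd/psdmx1.
(* [b] is the geometric bound on the partial sums of [phi (L^k I)]; the [+ 1] in [de] avoids a zero
   denominator and makes [de * b < eta] strict. *)
pose b := a * phi 1%:M / (1 - lambda).
have b0 : 0 <= b by apply: divr_ge0; [apply: mulr_ge0 => //|]; exact: ltW.
pose de := eta / (b + 1).
have de0 : 0 < de by rewrite divr_gt0// ltr_wpDl.
have deb : de * b < eta.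
  by rewrite /de mulrAC ltr_pdivrMr ?ltr_wpDl// ltr_pM2l// ltrDl.
pose N := M + de *: 1%:M.
have pN : psdmx N by exact: psdmxD M_psd (psdmxZ (ltW de0) (psdmx1 _ _)).
have [c c0 cN] := psd_bounded pN.
(* Since [N <= c I], decay gives [L^(K+1) N <= c a lambda^(K+1) I], so this [K] puts the tail below
   [de I]. The successor keeps the term [N] in [Q], whose share [de I] makes [Q] definite. *)
have [K KL] : exists K, c * a * lambda ^+ K.+1 < de.
  have : lambda ^+ k @[k --> \oo] --> 0 by apply: cvg_expr; rewrite gtr0_norm.
  have cde0 : 0 < de / (c * a) by rewrite divr_gt0// mulr_gt0.
  move=> /cvgrPdist_lt/(_ _ cde0)[K _ /(_ K.+1 (leqnSn K))] /=.
  rewrite sub0r normrN gtr0_norm ?exprn_gt0// ltr_pdivlMr ?mulr_gt0// => h1.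
  by exists K; rewrite mulrC.
pose Q := \sum_(k < K.+1) iter k L N.
have psum k : psdmx (\sum_(i < k) iter i.+1 L N).
  by elim/big_ind: _ => // *; [exact: psdmx0|exact: psdmxD|exact: iter_psd].
have QE : Q = N + \sum_(i < K) iter i.+1 L N by rewrite /Q big_ord_recl.
have pQ x : x != 0 -> 0 < qform Q x.
  move=> x0; rewrite QE !qformD qformZ -addrA ltr_wpDl ?M_psd.2//.
  by rewrite ltr_wpDr ?(psum K).2// mulr_gt0// qform1_gt0.
have LQ : Q - L Q - M = de *: 1%:M - iter K.+1 L N.
  have -> : L Q = \sum_(i < K) iter i.+1 L N + iter K.+1 L N.
    by rewrite /Q linear_sum big_ord_recr.
  rewrite QE /N; move: (\sum_(i < K) _) (iter K.+1 L _) => s t.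
  by apply/matrixP => i j; rewrite !mxE; ring.
have psdQ : psdmx Q by rewrite QE; exact: psdmxD.
exists Q; split.
- by split=> // ; exact: psdQ.1.
- rewrite LQ; split.
    have [sN _] := iter_psd K.+1 pN.
    by rewrite linearB/= sN linearZ/= trmx1.
  move=> x x0; rewrite -/(qform _ _) qformB qformZ subr_gt0.
  apply: le_lt_trans (psdle_qform x (iter_psdle K.+1 cN)) _.
  rewrite iterZ qformZ.
  apply: le_lt_trans (ler_wpM2l (ltW c0) (psdle_qform x (decay K.+1))) _.
  by rewrite qformZ !mulrA ltr_pM2r// qform1_gt0.
- rewrite /Q linear_sum/=.
  under eq_bigr do rewrite /N iterD iterZ linearD linearZ/=.
  rewrite big_split/=; apply: le_lt_trans (lerD (hM K.+1) (lexx _)) _.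
  rewrite ltrD2l -mulr_sumr; apply: le_lt_trans deb; rewrite ler_pM2l//.
  apply: (@le_trans _ _ (\sum_(k < K.+1) a * lambda ^+ k * phi 1%:M)).
    apply: ler_sum => k _; apply: le_trans (phi_psdle (decay k)) _.
    by rewrite linearZ.
  (* What remains is the finite geometric sum, at most [1 / (1 - lambda)]. *)
  rewrite -mulr_suml -mulr_sumr mulrAC /b ler_wpM2l ?mulr_ge0 ?(ltW a0)//.
  rewrite -[leRHS]mul1r ler_pdivlMr// mulrC.
  by rewrite -opprB mulNr -subrX1 opprB lerBlDr lerDl exprn_ge0// ltW.
Qed.

End lyapunov.

(** * The Lyapunov characterization for coefficients measurable everywhere *)

Section mean_congruence_theory.
Context d d' (T : measurableType d) (E : measurableType d') (R : realType).
Variable P : probability T R.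
Variable X : nat -> {mfun T >-> E}.
Hypothesis X_indep : forall (J : seq nat) (U : nat -> set E),
  uniq J -> (forall k, measurable (U k)) ->
  P (\bigcap_(k in [set` J]) (X k @^-1` U k)) =
  (\prod_(k <- J) P (X k @^-1` U k))%E.
Hypothesis X_id : forall k (U : set E), measurable U ->
  P (X k @^-1` U) = P (X 0%N @^-1` U).

Local Notation L1 f := (P.-integrable setT (EFin \o f)).

(** Quadratic forms are read as traces, so that the state vector and the matrix impulse response
    share the same lemmas. *)
Lemma trace11 (N : 'M[R]_1) : \tr N = N 0 0.
Proof. by rewrite /mxtrace big_ord1. Qed.

Lemma products_indep_of_future_cst k p q (V : 'M[R]_(p, q)) :
  products_indep_of_future P X k (cst V).
Proof.
move=> a b c; exact: (indep_of_future_cst X_indep (V a c * V b c)).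
Qed.

Lemma mean_congruence_is_linear p q (F : E -> 'M[R]_(p, q)) :
  mx_sqr_integrable P X F -> linear (mean_congruence P X F).
Proof.
move=> FF a N N'; apply/matrixP => i j.
have -> : (a *: mean_congruence P X F N + mean_congruence P X F N') i j =
    a * mean_congruence P X F N i j + mean_congruence P X F N' i j.
  by rewrite mxE [X in X + _]mxE.
rewrite !mean_congruenceE// big_distrr/= -big_split/=; apply: eq_bigr => k _.
rewrite big_distrr/= -big_split/=; apply: eq_bigr => l _.
by rewrite !mxE; ring.
Qed.

Lemma mean_congruence_psd p q (F : E -> 'M[R]_(p, q)) N :
  mx_sqr_integrable P X F -> psdmx N -> psdmx (mean_congruence P X F N).
Proof.
move=> FF [sN pN]; split.
  apply/matrixP => i j; rewrite !mxE; congr (fine 'E_P[_]%E).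
  apply/funext => t; set W := _ *m F _.
  have WT : W^T = W by rewrite !trmx_mul trmxK sN mulmxA.
  by rewrite -{1}WT mxE.
move=> x.
(* With the constant process [x] as [V], the form of the mean at [x] is the mean of the form of [N]
   at [F x]. *)
have [_ H] := expectation_trace_congruence X_indep X_id
  (products_indep_of_future_cst (k := 0%N) x)
  (mx_integrable_congruence N FF).
have -> : qform (mean_congruence P X F N) x =
    \int[P]_t \tr (x^T *m mean_congruence P X F N *m x).
  by rewrite Rintegral_probability_cst trace11.
rewrite -H; apply: Rintegral_ge0 => t _.
rewrite trace11 /=; have := pN (F (X 0%N t) *m x).
by rewrite /qform trmx_mul !mulmxA.
Qed.

Lemma psd_trace_ge0 p (N : 'M[R]_p) : psdmx N -> 0 <= \tr N.
Proof.
move=> [_ pN]; rewrite sumr_ge0// => i _; have := pN (delta_mx i 0).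
by rewrite /qform trmx_delta -rowE -colE !mxE.
Qed.

Lemma expectation_trace_congruence0 p q (F : E -> 'M[R]_(p, q)) N :
  mx_sqr_integrable P X F ->
  L1 (fun t => \tr ((F (X 0%N t))^T *m N *m F (X 0%N t))) /\
  \int[P]_t \tr ((F (X 0%N t))^T *m N *m F (X 0%N t)) =
  \tr (mean_congruence P X F N).
Proof.
move=> FF; have iH := mx_integrable_congruence N FF.
split; first by apply: integrable_Rsum => i; exact: (iH i i).2.
rewrite /mxtrace Rintegral_sum; last by move=> i; exact: (iH i i).2.
by apply: eq_bigr => i _; rewrite mxE fine_expectation.
Qed.

End mean_congruence_theory.

(** * Stability and the H2 norm in terms of [L], [M] and [phi] *)

Section square_integrable_system.
Context d (T : measurableType d) (R : realType) (P : probability T R).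
Context (Z n pw qz : nat).
Variable xi : nat -> {RV P >-> borel_mx R Z 1}.
Hypothesis xi_indep : mutually_independent xi.
Hypothesis xi_id : identically_distributed xi.
Variables (A : 'cV[R]_Z -> 'M[R]_(n, n)) (B : 'cV[R]_Z -> 'M[R]_(n, pw))
    (C : 'cV[R]_Z -> 'M[R]_(qz, n)) (D : 'cV[R]_Z -> 'M[R]_(qz, pw)).

Local Notation E := (borel_mx R Z 1).

Hypothesis AA : mx_sqr_integrable P xi (A : E -> _).
Hypothesis BB : mx_sqr_integrable P xi (B : E -> _).
Hypothesis CC : mx_sqr_integrable P xi (C : E -> _).
Hypothesis DD : mx_sqr_integrable P xi (D : E -> _).

Let G := System A B C D.
Let L := mean_congruence P xi (A : E -> _).
Let M := mean_congruence P xi (C : E -> _) 1%:M.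
Let phi (N : 'M[R]_n) := \tr (mean_congruence P xi (B : E -> _) N).
Let trD := \tr (mean_congruence P xi (D : E -> _) 1%:M).

Local Notation free_state x0 := (state xi G x0 (fun _ _ => 0)).

Lemma free_stateS x0 k t :
  free_state x0 k.+1 t = A (xi k t) *m free_state x0 k t.
Proof. by rewrite /= mulmx0 addr0. Qed.

Lemma free_state_indep x0 k :
  products_indep_of_future P xi k (free_state x0 k).
Proof.
elim: k => [|k IH].
  exact: (products_indep_of_future_cst xi_indep x0).
rewrite (funext (free_stateS x0 k)).
exact: (products_indep_of_futureM xi_indep xi_id IH AA).
Qed.

(** The weight is general because the induction removes the latest factor of the state, which
    changes [N] into [L N]. *)
Lemma Rintegral_free_state x0 k N :
  \int[P]_t \tr ((free_state x0 k t)^T *m N *m free_state x0 k t) =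
  qform (iter k L N) x0.
Proof.
elim: k N => [|k IH] N; first by rewrite /= Rintegral_probability_cst trace11.
rewrite iterSr -IH.
under eq_Rintegral do rewrite free_stateS.
exact: (expectation_step xi_indep xi_id N (@free_state_indep x0 k) AA).
Qed.

Lemma mx_integrable_cst p q (N : 'M[R]_(p, q)) :
  mx_integrable P xi (fun _ : E => N).
Proof.
move=> i j; split; first exact: measurable_cst.
exact: finite_measure_integrable_cst.
Qed.

Lemma expectation_eucl_norm x0 k :
  'E_P[(fun t => eucl_norm (free_state x0 k t) ^+ 2)%R]%E =
  (qform (iter k L 1%:M) x0)%:E.
Proof.
have [iY _] := expectation_trace_congruence xi_indep xi_id
  (@free_state_indep x0 k)
  (mx_integrable_cst 1%:M).
rewrite -Rintegral_free_state -expectation_Rintegral//.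
congr (expectation P _); apply/funext => t.
rewrite trace11 -/(qform _ _) qform1 /eucl_norm sqr_sqrtr//.
by rewrite sumr_ge0// => i _; exact: sqr_ge0.
Qed.

(** The state at time [k.+1] due to a unit input at time 0; it involves [xi 0] up to [xi k], and the
    shift makes [B (xi 0)] the initial value. *)
Let impulse k t := transition xi G 1 k.+1 t *m B (xi 0%N t).

Lemma impulseS k t : impulse k.+1 t = A (xi k.+1 t) *m impulse k t.
Proof. by rewrite /impulse /transition !subn1/= add1n mulmxA. Qed.

Lemma impulse0 : impulse 0 = fun t => B (xi 0%N t).
Proof. by apply/funext => t; rewrite /impulse /transition subn1/= mul1mx. Qed.

Lemma impulse_indep k : products_indep_of_future P xi k.+1 (impulse k).
Proof.
elim: k => [|k IH].
  rewrite impulse0 => a b c.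
  have [mB iB] := mx_sqr_integrableM a c b c BB.
  (* The constant 1, multiplied by a product of two entries of [B (xi 0)]. *)
  have [+ _] := indep_of_futureM (indep_of_future_cst xi_indep (k := 0%N) 1) mB iB.
  by apply: eq_indep_of_future => t /=; rewrite mul1r.
rewrite (funext (impulseS k)).
exact: (products_indep_of_futureM xi_indep xi_id IH AA).
Qed.

Lemma Rintegral_impulse k N :
  \int[P]_t \tr ((impulse k t)^T *m N *m impulse k t) = phi (iter k L N).
Proof.
elim: k N => [|k IH] N.
  by rewrite impulse0 (expectation_trace_congruence0 N BB).2.
rewrite iterSr -IH.
under eq_Rintegral do rewrite impulseS.
exact: (expectation_step xi_indep xi_id N (@impulse_indep k) AA).
Qed.

Lemma expectation_impulse k :
  'E_P[(fun t => \tr ((B (xi 0%N t))^T *m (transition xi G 1 k.+1 t)^T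
     *m (C (xi k.+1 t))^T *m C (xi k.+1 t)
     *m transition xi G 1 k.+1 t *m B (xi 0%N t)))%R]%E =
  (phi (iter k L M))%:E.
Proof.
have [iY EY] := expectation_trace_congruence xi_indep xi_id (@impulse_indep k)
  (mx_integrable_congruence 1%:M CC).
rewrite -Rintegral_impulse -EY -expectation_Rintegral//.
congr (expectation P _); apply/funext => t.
by rewrite /impulse trmx_mul mulmx1 !mulmxA.
Qed.

Lemma h2_partialE K :
  h2_partial P xi G K = (trD + \sum_(k < K) phi (iter k L M))%:E.
Proof.
rewrite /h2_partial EFinD; congr (_ + _)%E.
  rewrite /trD -(expectation_trace_congruence0 1%:M DD).2.
  rewrite -expectation_Rintegral; last first.
    exact: (expectation_trace_congruence0 1%:M DD).1.
  by congr (expectation P _); apply/funext => t; rewrite mulmx1.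
rewrite big_add1/= big_mkord -sumEFin; apply: eq_bigr => k _.
exact: expectation_impulse.
Qed.

Lemma mx_expectation_lyapunov Q :
  mx_expectation P (fun t => Q - (A (xi 0%N t))^T *m Q *m A (xi 0%N t)
    - (C (xi 0%N t))^T *m C (xi 0%N t)) = Q - L Q - M.
Proof.
apply/matrixP => i j; rewrite !mxE !fine_expectation.
have iA := (mx_integrable_congruence Q AA i j).2.
have iC := (mx_integrable_congruence 1%:M CC i j).2.
have iQ := (mx_integrable_cst Q i j).2.
rewrite -[X in X - _ - _](Rintegral_probability_cst P).
have iQA := integrableB measurableT iQ iA.
rewrite -RintegralB// -RintegralB//.
by apply: eq_Rintegral => t _; rewrite mulmx1 !mxE.
Qed.

Lemma expectation_trace_DB Q :
  'E_P[(fun t => \tr ((D (xi 0%N t))^T *m D (xi 0%N t)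
     + (B (xi 0%N t))^T *m Q *m B (xi 0%N t)))%R]%E = (trD + phi Q)%:E.
Proof.
have [iD eD] := expectation_trace_congruence0 1%:M DD.
have [iB eB] := expectation_trace_congruence0 Q BB.
rewrite /trD /phi -eD -eB -RintegralD// -expectation_Rintegral; last first.
  exact: integrableD iD iB.
by congr (expectation P _); apply/funext => t; rewrite mulmx1 linearD.
Qed.

(** Negative values and [-oo] have square root 0, so both sides hold there; at [+oo] both fail. *)
Lemma sqrte_lt (x : \bar R) (c : R) : 0 < c ->
  (sqrte x < c%:E)%E = (x < (c ^+ 2)%:E)%E.
Proof.
move=> c0; have c2 : (0 <= (c ^+ 2)%:E)%E by rewrite lee_fin sqr_ge0.
have cE : c%:E = sqrte (c ^+ 2)%:E by rewrite /= sqrtr_sqr gtr0_norm.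
case: x => [x||]; last 2 first.
- by rewrite /= !ltNge !leey.
- by rewrite /= lte_fin c0 ltNyr.
rewrite /= !lte_fin.
have [x0|x0] := leP 0 x.
  by rewrite -[c in LHS]gtr0_norm// -sqrtr_sqr ltr_sqrt// exprn_gt0.
by rewrite ltr0_sqrtr// c0 (lt_le_trans x0)// sqr_ge0.
Qed.

Lemma lyapunov_characterization (gamma : R) : 0 < gamma ->
  (exp_stable2 P xi G /\ (h2norm P xi G < gamma%:E)%E)
  <->
  (exists Q : 'M[R]_n,
    [/\ posdefmx Q,
        posdefmx (mx_expectation P (fun t =>
          Q - (A (xi 0%N t))^T *m Q *m A (xi 0%N t)
            - (C (xi 0%N t))^T *m C (xi 0%N t))) &
        ('E_P[(fun t => \tr ((D (xi 0%N t))^T *m D (xi 0%N t)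
                          + (B (xi 0%N t))^T *m Q *m B (xi 0%N t)))%R]
          < (gamma ^+ 2)%:E)%E]).
Proof.
move=> gamma0.
have L_lin : linear L := mean_congruence_is_linear AA.
have phi_lin : scalar phi.
  by move=> a N N'; rewrite /phi mean_congruence_is_linear// linearP.
(* Linearity rests on square integrability, so the linear structures are built inside the proof. *)
pose Ll : {linear 'M[R]_n -> 'M[R]_n} :=
  HB.pack L (GRing.isLinear.Build R 'M[R]_n 'M[R]_n *:%R L L_lin).
pose phil : {scalar 'M[R]_n} :=
  HB.pack phi (GRing.isLinear.Build R 'M[R]_n R *%R phi phi_lin).
have L_psd N : psdmx N -> psdmx (Ll N) := mean_congruence_psd xi_indep xi_id AA.
have phi_psd N : psdmx N -> 0 <= phil N.
  by move=> pN; exact/psd_trace_ge0/mean_congruence_psd.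
have M_psd : psdmx M by apply: mean_congruence_psd => //; exact: psdmx1.
have trD0 : 0 <= trD.
  by apply/psd_trace_ge0/mean_congruence_psd => //; exact: psdmx1.
pose u K := trD + \sum_(k < K) phi (iter k L M).
have h2E : h2_partial P xi G = EFin \o u by apply/funext => K; exact: h2_partialE.
have u_nd : {homo (EFin \o u) : i j / (i <= j)%N >-> (i <= j)%E}.
  apply/nondecreasing_seqP => k; rewrite lee_fin /u big_ord_recr/= addrA lerDl.
  by apply: phi_psd; exact: (iter_psd L_psd).
have h2_cvg := ereal_nondecreasing_is_cvgn u_nd.
rewrite /h2norm sqrte_lt// h2E.
have lim_u : limn (EFin \o u) = ereal_sup (range (EFin \o u)).
  exact/cvg_lim/ereal_nondecreasing_cvgn.
have normE x : eucl_norm x = Num.sqrt (qform 1%:M x) by rewrite qform1.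
split=> [[[a [lambda [a0 l0 l1 stab]]]]|[Q [pQ pS trQ]]].
(* Stability bounds the root of the second moment, hence the squared constants; the converse
   direction takes square roots. *)
- have decay k : psdle (iter k Ll 1%:M) ((a ^+ 2 * (lambda ^+ 2) ^+ k) *: 1%:M).
    apply: psdle_qformP; first exact: (iter_psd L_psd k (psdmx1 _ _)).
      apply: psdmxZ (psdmx1 _ _).
      by rewrite mulr_ge0 ?sqr_ge0// exprn_ge0 ?sqr_ge0.
    move=> x; have := stab k x; rewrite expectation_eucl_norm /= lee_fin normE.
    have q0 : 0 <= qform (iter k L 1%:M) x.
      exact: (iter_psd L_psd k (psdmx1 _ _)).2.
    have rhs0 : 0 <= a * Num.sqrt (qform 1%:M x) * lambda ^+ k.
      by rewrite !mulr_ge0 ?sqrtr_ge0 ?exprn_ge0// ltW.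
    rewrite -(ler_pXn2r (n := 2)) ?nnegrE ?sqrtr_ge0// sqr_sqrtr//.
    move=> /le_trans; apply; rewrite qformZ !exprMn sqr_sqrtr ?qform1_ge0//.
    by rewrite -expr2 mulrAC.
  have uK_le K : ((u K)%:E <= limn (EFin \o u))%E.
    by rewrite lim_u; apply: ereal_sup_ubound; exists K.
  (* The norm bound excludes [+oo], and the term at 0 excludes [-oo]. *)
  case: (limn (EFin \o u)) uK_le => [r uK_le|//|/(_ 0%N)//].
  rewrite lte_fin => r_lt.
  have sum_le K : \sum_(k < K) phil (iter k Ll M) <= r - trD.
    by rewrite lerBrDl -lee_fin; exact: uK_le.
  (* With [h = r - trD] and this slack as [eta], [h + eta] is exactly [gamma^2 - trD]. *)
  have eta0 : 0 < gamma ^+ 2 - r by rewrite subr_gt0.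
  have l2 : lambda ^+ 2 < 1 by rewrite expr_lt1// ltW.
  have [Q [pQ pS phiQ]] := lyapunov_exists L_psd phi_psd M_psd
    (exprn_gt0 2 a0) (exprn_gt0 2 l0) l2 eta0 decay sum_le.
  exists Q; split=> //; first by rewrite mx_expectation_lyapunov.
  rewrite expectation_trace_DB lte_fin.
  by move: phiQ; rewrite -[phil Q]/(phi Q); lra.
- rewrite mx_expectation_lyapunov in pS.
  rewrite expectation_trace_DB lte_fin in trQ.
  split; last first.
    (* This bound is uniform in [K], so the strict inequality survives the limit. *)
    rewrite lim_u; apply: (@le_lt_trans _ _ (trD + phi Q)%:E); last first.
      by rewrite lte_fin.
    apply: ge_ereal_sup => _ [K _ <-]; rewrite lee_fin lerD2l.
    exact: (lyapunov_telescope L_psd phi_psd K pQ pS).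
  have [a [lambda [a0 l0 l1 decay]]] := lyapunov_decay L_psd M_psd pQ pS.
  exists (Num.sqrt a), (Num.sqrt lambda); split; rewrite ?sqrtr_gt0//.
    by rewrite -sqrtr1 ltr_sqrt.
  move=> k x; rewrite expectation_eucl_norm /= lee_fin normE.
  have sqrt_exp : Num.sqrt (lambda ^+ k) = Num.sqrt lambda ^+ k.
    elim: k => [|k IH]; first by rewrite !expr0 sqrtr1.
    by rewrite !exprS sqrtrM ?ltW// IH.
  have -> : Num.sqrt a * Num.sqrt (qform 1%:M x) * Num.sqrt lambda ^+ k =
      Num.sqrt (a * lambda ^+ k * qform 1%:M x).
    have al0 : 0 <= a * lambda ^+ k by rewrite mulr_ge0 ?exprn_ge0// ltW.
    by rewrite -sqrt_exp (sqrtrM _ al0) (sqrtrM _ (ltW a0)) mulrAC.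
  by apply: ler_wsqrtr; have := psdle_qform x (decay k); rewrite qformZ.
Qed.

End square_integrable_system.

(** * Coefficients measurable on the support only *)

Section expectation_almost_sure.
Import HBNNSimple.
Context d (T : measurableType d) (R : realType) (P : probability T R).
Variable S : set T.
Hypothesis mS : measurable S.
Hypothesis PS : P S = 1%E.

(** The integral is a supremum over simple functions below the integrand, measurable or not. If
    [h <= f], then [h] times the indicator of [S] lies below [g] and has the same integral as [h];
    exchange [f] and [g]. *)
Lemma ge0_integral_almost_sure (f g : T -> \bar R) :
  (forall t, 0 <= f t)%E -> (forall t, 0 <= g t)%E ->
  (forall t, S t -> f t = g t) -> (\int[P]_t f t = \int[P]_t g t)%E.
Proof.
have PSC : P (~` S) = 0%E by rewrite probability_setC// PS subee.
have le_fg (f' g' : T -> \bar R) : (forall t, 0 <= f' t)%E ->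
    (forall t, 0 <= g' t)%E -> (forall t, S t -> f' t = g' t) ->
    (\int[P]_t f' t <= \int[P]_t g' t)%E.
  move=> f0 g0 fg; rewrite !ge0_integralTE//.
  apply: ge_ereal_sup => _ [h /= hf <-]; apply: ereal_sup_ubound => /=.
  exists (mul_nnsfun h (indic_nnsfun R mS)).
    move=> t; rewrite -[leLHS]/((h t * \1_S t)%:E) indicE.
    case: (boolP (t \in S)) => [tS|tS].
      by rewrite mulr1 -fg//; exact: set_mem.
    by rewrite mulr0 g0.
  rewrite -!integralT_nnsfun; apply: ge0_ae_eq_integral => //.
  - by apply/measurable_EFinP.
  - by apply/measurable_EFinP.
  - by move=> t _; rewrite lee_fin.
  - by move=> t _; rewrite lee_fin.
  exists (~` S); split=> //; first exact: measurableC.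
  move=> t /= /not_implyP[_ neq] tS; apply: neq.
  by rewrite -[LHS]/((h t * \1_S t)%:E) indicE mem_set// mulr1.
move=> f0 g0 fg; apply/eqP; rewrite eq_le !le_fg// => t /fg.
by [].
Qed.

(* No measurability is assumed, because the coefficients of the system are
   arbitrary off the support. *)
Lemma expectation_almost_sure (f g : T -> R) :
  (forall t, S t -> f t = g t) -> 'E_P[f]%E = 'E_P[g]%E.
Proof.
move=> fg; rewrite unlock integralE [RHS]integralE.
congr (_ - _)%E; apply: ge0_integral_almost_sure => // t /fg E.
  by rewrite !funepos.unlock E.
by rewrite !funeneg.unlock E.
Qed.

End expectation_almost_sure.

(** * Borel matrices and restriction to a closed set *)

Section borel_matrices.
Context (R : realType).

Lemma closed_borel_measurable m n (F : set 'M[R]_(m, n)) :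
  closed F -> measurable (F : set (borel_mx R m n)).
Proof.
move=> cF; rewrite -[F]setCK; apply: measurableC.
by apply: sub_sigma_algebra; exact: closed_openC.
Qed.

Lemma measurable_coord m n i j :
  measurable_fun setT (fun M : borel_mx R m n => (M : 'M[R]_(m, n)) i j).
Proof.
apply: (measurability _ (RGenOpens.measurableE R)).
move=> _ [_ [a [b ->] <-]]; rewrite setTI; apply: sub_sigma_algebra.
have /continuousP := @coord_continuous R m n i j; apply.
exact: interval_open.
Qed.

(** Entrywise, so that measurability reduces to that of real functions patched by a constant off
    [S]. *)
Definition restrict_mx Z m n (S : set 'cV[R]_Z)
    (F : 'cV[R]_Z -> 'M[R]_(m, n)) x :=
  \matrix_(i, j) ((fun x => F x i j) \_ S) x.

Lemma restrict_mxE Z m n (S : set 'cV[R]_Z)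
    (F : 'cV[R]_Z -> 'M[R]_(m, n)) x :
  S x -> restrict_mx S F x = F x.
Proof. by move=> Sx; apply/matrixP => i j; rewrite mxE patchE mem_set. Qed.

Lemma measurable_restrict_mx Z m n (S : set 'cV[R]_Z)
    (F : 'cV[R]_Z -> 'M[R]_(m, n)) i j : closed S ->
  measurable_fun (S : set (borel_mx R Z 1)) (F : _ -> borel_mx R m n) ->
  measurable_fun setT (fun x : borel_mx R Z 1 => restrict_mx S F x i j).
Proof.
move=> /closed_borel_measurable mS mF.
rewrite (_ : (fun x : borel_mx R Z 1 => restrict_mx S F x i j) =
  (fun x : borel_mx R Z 1 => F x i j) \_ (S : set (borel_mx R Z 1))); last first.
  by apply/funext => x; rewrite mxE.
apply/(measurable_restrictT _ mS).
exact: (measurableT_comp (@measurable_coord m n i j) mF).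
Qed.

End borel_matrices.

(** * Systems whose coefficients agree almost surely *)

Section almost_sure_coefficients.
Context d (T : measurableType d) (R : realType) (P : probability T R).
Context (Z n pw qz : nat).
Variables (xi : nat -> T -> 'cV[R]_Z) (G G' : system R Z n pw qz).
Variable S : set T.
Hypothesis mS : measurable S.
Hypothesis PS : P S = 1%E.
Hypothesis GG' : forall t, S t -> forall k,
  [/\ sysA G (xi k t) = sysA G' (xi k t), sysB G (xi k t) = sysB G' (xi k t),
      sysC G (xi k t) = sysC G' (xi k t) & sysD G (xi k t) = sysD G' (xi k t)].

Lemma state_almost_sure x0 w k t : S t ->
  state xi G x0 w k t = state xi G' x0 w k t.
Proof.
by move=> St; elim: k => //= k ->; have [-> -> _ _] := GG' St k.
Qed.

Lemma transition_almost_sure k1 k2 t : S t ->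
  transition xi G k1 k2 t = transition xi G' k1 k2 t.
Proof.
move=> St; rewrite /transition; elim: (k2 - k1)%N => //= k ->.
by have [-> _ _ _] := GG' St (k1 + k)%N.
Qed.

Lemma exp_stable2_almost_sure : exp_stable2 P xi G <-> exp_stable2 P xi G'.
Proof.
have EE k x0 :
    'E_P[(fun t => eucl_norm (state xi G x0 (fun _ _ => 0) k t) ^+ 2)%R]%E =
    'E_P[(fun t => eucl_norm (state xi G' x0 (fun _ _ => 0) k t) ^+ 2)%R]%E.
  by apply: (expectation_almost_sure mS PS) => t St; rewrite state_almost_sure.
by split=> -[a [l [a0 l0 l1 H]]]; exists a, l; split=> // k x0;
  [rewrite -EE|rewrite EE].
Qed.

Lemma h2norm_almost_sure : h2norm P xi G = h2norm P xi G'.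
Proof.
rewrite /h2norm; congr (sqrte (limn _)); apply/funext => K; rewrite /h2_partial.
congr (_ + _)%E.
  apply: (expectation_almost_sure mS PS) => t St.
  by have [_ _ _ ->] := GG' St 0%N.
apply: eq_bigr => k _; apply: (expectation_almost_sure mS PS) => t St.
rewrite transition_almost_sure//; have [_ -> _ _] := GG' St 0%N.
by have [_ _ -> _] := GG' St k.
Qed.

End almost_sure_coefficients.

Theorem theorem3 (R : realType) (d : measure_display) (T : measurableType d)
    (P : probability T R) (Z n pw qz : nat)
    (xi : nat -> {RV P >-> borel_mx R Z 1})
    (xi_indep : mutually_independent xi) (xi_id : identically_distributed xi)
    (Xi : set 'cV[R]_Z) (XiP : forall k, is_support (xi k) Xi)
    (A : 'cV[R]_Z -> 'M[R]_(n, n)) (B : 'cV[R]_Z -> 'M[R]_(n, pw))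
    (C : 'cV[R]_Z -> 'M[R]_(qz, n)) (D : 'cV[R]_Z -> 'M[R]_(qz, pw))
    (mA : measurable_fun (Xi : set (borel_mx R Z 1)) (A : _ -> borel_mx R n n))
    (mB : measurable_fun (Xi : set (borel_mx R Z 1)) (B : _ -> borel_mx R n pw))
    (mC : measurable_fun (Xi : set (borel_mx R Z 1)) (C : _ -> borel_mx R qz n))
    (mD : measurable_fun (Xi : set (borel_mx R Z 1)) (D : _ -> borel_mx R qz pw))
    (A2 : forall i j, ('E_P[(fun t => A (xi 0%N t) i j ^+ 2)%R] < +oo)%E)
    (B2 : forall i j, ('E_P[(fun t => B (xi 0%N t) i j ^+ 2)%R] < +oo)%E)
    (C2 : forall i j, ('E_P[(fun t => C (xi 0%N t) i j ^+ 2)%R] < +oo)%E)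
    (D2 : forall i j, ('E_P[(fun t => D (xi 0%N t) i j ^+ 2)%R] < +oo)%E)
    (gamma : R) (gamma_gt0 : 0 < gamma) :
  (exp_stable2 P xi (System A B C D) /\
   (h2norm P xi (System A B C D) < gamma%:E)%E)
  <->
  (exists Q : 'M[R]_n,
    [/\ posdefmx Q,
        posdefmx (mx_expectation P (fun t =>
          Q - (A (xi 0%N t))^T *m Q *m A (xi 0%N t)
            - (C (xi 0%N t))^T *m C (xi 0%N t))) &
        ('E_P[(fun t => \tr ((D (xi 0%N t))^T *m D (xi 0%N t)
                          + (B (xi 0%N t))^T *m Q *m B (xi 0%N t)))%R]
          < (gamma ^+ 2)%:E)%E]).
Proof.
have cXi : closed Xi by case: (XiP 0%N).
have mXi k : measurable (xi k @^-1` Xi).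
  rewrite -[X in measurable X]setTI.
  exact: (measurable_funPT (xi k)) (closed_borel_measurable cXi).
(* One event serves all times, because states and transition matrices involve several [xi k] at
   once; its complement is a countable union of null events. *)
pose S := \bigcap_k (xi k @^-1` Xi).
have mS : measurable S by exact: bigcapT_measurable.
have PS : P S = 1%E.
  have PSC : P (~` S) = 0%E.
    rewrite setC_bigcap; apply/eqP; rewrite -measure_le0.
    apply: le_trans (measure_sigma_subadditive _ _ _ _) _.
    - by move=> k; exact: measurableC (mXi k).
    - by apply: bigcup_measurable => k _; exact: measurableC (mXi k).
    - exact: subset_refl.
    rewrite eseries0// => k _ _.
    by have [_ PXi _] := XiP k; rewrite /= probability_setC// PXi subee.
  by rewrite -[S]setCK probability_setC ?PSC ?sube0//; exact: measurableC.
have restrictE p q (F : 'cV[R]_Z -> 'M[R]_(p, q)) k t : S t ->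
    F (xi k t) = restrict_mx Xi F (xi k t).
  by move=> /(_ k I) Xit; rewrite restrict_mxE.
have sqrI p q (F : 'cV[R]_Z -> 'M[R]_(p, q)) :
    measurable_fun (Xi : set (borel_mx R Z 1)) (F : _ -> borel_mx R p q) ->
    (forall i j, ('E_P[(fun t => F (xi 0%N t) i j ^+ 2)%R] < +oo)%E) ->
    mx_sqr_integrable P xi (restrict_mx Xi F : borel_mx R Z 1 -> _).
  move=> mF F2 i j; have mr := @measurable_restrict_mx R Z p q Xi F i j cXi mF.
  split=> //; apply: integrable_sqr.
    exact: (measurableT_comp mr (measurable_funPT (xi 0%N))).
  rewrite (_ : 'E_P[_]%E = 'E_P[(fun t => F (xi 0%N t) i j ^+ 2)%R]%E)//.
  by apply: (expectation_almost_sure mS PS) => t St; rewrite -restrictE.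
(* These coefficients are measurable on the whole space and agree with the given ones along every
   trajectory in [S]. *)
pose G' := System (restrict_mx Xi A) (restrict_mx Xi B) (restrict_mx Xi C)
  (restrict_mx Xi D).
have GG' t : S t -> forall k,
    [/\ sysA (System A B C D) (xi k t) = sysA G' (xi k t),
        sysB (System A B C D) (xi k t) = sysB G' (xi k t),
        sysC (System A B C D) (xi k t) = sysC G' (xi k t) &
        sysD (System A B C D) (xi k t) = sysD G' (xi k t)].
  by move=> St k; split; exact: restrictE.
rewrite (exp_stable2_almost_sure mS PS GG') (h2norm_almost_sure mS PS GG').
have H := lyapunov_characterization xi_indep xi_id (sqrI _ _ _ mA A2)
  (sqrI _ _ _ mB B2) (sqrI _ _ _ mC C2) (sqrI _ _ _ mD D2) gamma_gt0.
apply: (iff_trans H).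
have E1 Q : mx_expectation P (fun t => Q - (A (xi 0%N t))^T *m Q *m A (xi 0%N t)
      - (C (xi 0%N t))^T *m C (xi 0%N t)) =
    mx_expectation P (fun t => Q - (restrict_mx Xi A (xi 0%N t))^T *m Q
      *m restrict_mx Xi A (xi 0%N t)
      - (restrict_mx Xi C (xi 0%N t))^T *m restrict_mx Xi C (xi 0%N t)).
  apply/matrixP => i j; rewrite !mxE; congr fine.
  by apply: (expectation_almost_sure mS PS) => t St; rewrite -!restrictE.
have E2 Q : 'E_P[(fun t => \tr ((D (xi 0%N t))^T *m D (xi 0%N t)
      + (B (xi 0%N t))^T *m Q *m B (xi 0%N t)))%R]%E =
    'E_P[(fun t => \tr ((restrict_mx Xi D (xi 0%N t))^T
      *m restrict_mx Xi D (xi 0%N t) + (restrict_mx Xi B (xi 0%N t))^T *m Q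
      *m restrict_mx Xi B (xi 0%N t)))%R]%E.
  by apply: (expectation_almost_sure mS PS) => t St; rewrite -!restrictE.
by split=> -[Q [pQ pS trQ]]; exists Q; [rewrite E1 E2|rewrite -E1 -E2].
Qed.
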